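(* Let $k,g,\rho>0$, $b_0\le 0$, $P_0\in\mathbb{R}$, $\omega=0$, and assume that $m\in\mathbb{R}$ satisfies $$m^2=\frac{g}{k}.$$ Let $c\in\mathbb{R}$ be arbitrary. Let $(u,w)$ be the velocity field associated with the particle paths $(X,Z)$ (see context), and let the pressure be $$P:=\frac{\rho m(km+2\omega)}{2k}\left(e^{2kb}-e^{2kb_0}\right)+\left[2\omega\rho(c-m)-g\rho\right](b-b_0)+P_0,\qquad b\le b_0,$$ (with $\omega=0$), regarded as a function of $(t,X,Z)$ through $(a,b)=\Phi(t)^{-1}(X,Z)$. Then, for all $t\ge0$, $$u_t+uu_X+wu_Z+2\omega w=-\frac{P_X}{\rho},\qquad w_t+uw_X+ww_Z-2\omega u=-\frac{P_Z}{\rho}-g\qquad\text{in }\Omega(t),$$ with $\omega=0$.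
   Context: For $t\ge 0$, $a\in\mathbb{R}$, $b\le b_0$ the particle paths are $$X(t,a,b):=a+(c-m)t-\frac{e^{kb}}{k}\sin(k(a-mt)),\qquad Z(t,a,b):=b+\frac{e^{kb}}{k}\cos(k(a-mt)).$$ Set $\Sigma:=\mathbb{R}\times(-\infty,b_0)$ and $\Phi(t):=(X(t,\cdot,\cdot),Z(t,\cdot,\cdot))$. For each $t\ge0$, $\Phi(t)$ is a real-analytic diffeomorphism of $\Sigma$ onto the fluid domain $\Omega(t):=\Phi(t)(\Sigma)$. The velocity field is defined by $$u(t,X,Z)=X_t(t,a,b)\big|_{(a,b)=\Phi(t)^{-1}(X,Z)},\qquad w(t,X,Z)=Z_t(t,a,b)\big|_{(a,b)=\Phi(t)^{-1}(X,Z)}.$$ *)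

(* Defs.v *)
From Stdlib Require Import Reals ClassicalEpsilon.
From Coquelicot Require Import Coquelicot.
Open Scope R_scope.

Definition pathX (k c m t a b : R) : R :=
  a + (c - m) * t - exp (k * b) / k * sin (k * (a - m * t)).

Definition pathZ (k m t a b : R) : R :=
  b + exp (k * b) / k * cos (k * (a - m * t)).

Definition Sigma (b0 : R) (q : R * R) : Prop := snd q < b0.

Definition Phi (k c m t : R) (q : R * R) : R * R :=
  (pathX k c m t (fst q) (snd q), pathZ k m t (fst q) (snd q)).

Definition Omega (k c m b0 t : R) (p : R * R) : Prop :=
  exists q : R * R, Sigma b0 q /\ Phi k c m t q = p.

(* The inverse of [Phi k c m t] restricted to [Sigma b0]. For 0 < k and b0 <= 0
   this restriction is injective, so the preimage picked is the only one; the
   value is unspecified outside [Omega k c m b0 t]. *)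
Definition Phi_inv (k c m b0 t : R) (p : R * R) : R * R :=
  epsilon (inhabits (0, 0)) (fun q => Sigma b0 q /\ Phi k c m t q = p).

Definition velU (k c m b0 t X Z : R) : R :=
  let q := Phi_inv k c m b0 t (X, Z) in
  Derive (fun s => pathX k c m s (fst q) (snd q)) t.

Definition velW (k c m b0 t X Z : R) : R :=
  let q := Phi_inv k c m b0 t (X, Z) in
  Derive (fun s => pathZ k m s (fst q) (snd q)) t.

Definition pressure_label (k g rho b0 P0 omega m c b : R) : R :=
  rho * m * (k * m + 2 * omega) / (2 * k) * (exp (2 * k * b) - exp (2 * k * b0))
  + (2 * omega * rho * (c - m) - g * rho) * (b - b0) + P0.

Definition pressure (k g rho b0 P0 omega m c t X Z : R) : R :=
  pressure_label k g rho b0 P0 omega m c (snd (Phi_inv k c m b0 t (X, Z))).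

(* Derivative in time of a quantity that is only considered for t >= 0: the
   usual derivative when t > 0, the right derivative when t = 0. *)
Definition is_time_derive (f : R -> R) (t l : R) : Prop :=
  filterdiff f (within (fun s => 0 <= s) (locally t)) (fun h => scal h l).

(* Main.v *)
(** Subtracting [c * t] from [X] makes the flow steady: with [alpha = a - m * t],
the labels are recovered from [(X - c * t, Z)] by inverting the time-independent
map [F (alpha, b) = (alpha - e^(kb)/k sin(k alpha), b + e^(kb)/k cos(k alpha))].
On [b <= M < 0] this is the identity plus a map with Lipschitz constant
[e^(kM) < 1], so [F] is injective, and open by the contraction principle. Its
Jacobian determinant [1 - e^(2kb)] does not vanish, which gives the derivatives
of the inverse along any line. With [E = e^(kb)], the relative velocity is
[(u - c, w) = m (E cos - 1, E sin)]: along it [alpha] has derivative [-m] and [b]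
is constant, so the acceleration is [k m^2 E (sin, - cos)]; it balances pressure
and gravity because [k m^2 = g]. *)

Require Import Defs.
From Stdlib Require Import Reals ClassicalEpsilon Lra.
From Coquelicot Require Import Coquelicot.
Open Scope R_scope.

(** * Planar contractions and differentiability on the line *)

Lemma Rabs_le_of_sqr (x y : R) : 0 <= y -> x ^ 2 <= y ^ 2 -> Rabs x <= y.
Proof.
intros hy h.
rewrite <- (Rabs_pos_eq y hy).
apply Rsqr_le_abs_0; unfold Rsqr; nra.
Qed.

Lemma Rabs_le_of_sum_sqr (x y v : R) :
  v ^ 2 <= x ^ 2 + y ^ 2 -> Rabs v <= Rabs x + Rabs y.
Proof.
intros h.
assert (hx := Rabs_pos x); assert (hy := Rabs_pos y).
apply Rabs_le_of_sqr; [lra|].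
rewrite <- (pow2_abs x), <- (pow2_abs y) in h.
nra.
Qed.

Lemma is_lim_seq_of_ex_series_diff (u : nat -> R) :
  ex_series (fun n => u (S n) - u n) -> exists l : R, is_lim_seq u l.
Proof.
intros [s hs].
exists (u 0%nat + s).
apply is_lim_seq_incr_1.
apply is_lim_seq_ext with (fun n => u 0%nat + sum_n (fun i => u (S i) - u i) n).
- intros n; induction n as [|n IH].
  + rewrite sum_O; ring.
  + rewrite sum_Sn; unfold plus; simpl; simpl in IH; lra.
- apply (is_lim_seq_plus' (fun _ => u 0%nat) _ (u 0%nat) s).
  + apply is_lim_seq_const.
  + exact hs.
Qed.

(** Banach's fixed point theorem for the Euclidean norm, kept in squared form. Each coordinate of
    the Picard iterates has increments dominated by a geometric series, hence converges, and
    continuity makes the limit a fixed point. *)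
Lemma planar_contraction_fixpoint (f1 f2 : R -> R -> R) (L : R) :
  0 <= L < 1 ->
  (forall a b a' b', (f1 a b - f1 a' b') ^ 2 + (f2 a b - f2 a' b') ^ 2
     <= L ^ 2 * ((a - a') ^ 2 + (b - b') ^ 2)) ->
  exists a b, f1 a b = a /\ f2 a b = b.
Proof.
intros hL hf.
pose (q := fix q n := match n with O => (0, 0)
  | S n => (f1 (fst (q n)) (snd (q n)), f2 (fst (q n)) (snd (q n))) end).
assert (hq1 : forall n, f1 (fst (q n)) (snd (q n)) = fst (q (S n))) by reflexivity.
assert (hq2 : forall n, f2 (fst (q n)) (snd (q n)) = snd (q (S n))) by reflexivity.
clearbody q.
set (D := (fst (q 1%nat) - fst (q 0%nat)) ^ 2 + (snd (q 1%nat) - snd (q 0%nat)) ^ 2).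
assert (hD : 0 <= D) by (apply Rplus_le_le_0_compat; apply pow2_ge_0).
assert (hstep : forall n, (fst (q (S n)) - fst (q n)) ^ 2
   + (snd (q (S n)) - snd (q n)) ^ 2 <= (L ^ n * sqrt D) ^ 2).
{ intros n; induction n as [|n IH].
  - rewrite Rpow_mult_distr, pow2_sqrt by exact hD. fold D. simpl; lra.
  - assert (h := hf (fst (q (S n))) (snd (q (S n))) (fst (q n)) (snd (q n))).
    rewrite !hq1, !hq2 in h. apply Rle_trans with (1 := h).
    replace ((L ^ S n * sqrt D) ^ 2) with (L ^ 2 * (L ^ n * sqrt D) ^ 2) by (simpl; ring).
    apply Rmult_le_compat_l; [apply pow2_ge_0 | exact IH]. }
assert (hgeom : ex_series (fun n => L ^ n * sqrt D)).
{ apply ex_series_scal_r, ex_series_geom. rewrite Rabs_pos_eq; lra. }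
assert (hpos : forall n, 0 <= L ^ n * sqrt D).
{ intros n; apply Rmult_le_pos; [apply pow_le; lra | apply sqrt_pos]. }
destruct (is_lim_seq_of_ex_series_diff (fun n => fst (q n))) as [a ha].
{ apply (ex_series_le (K := R_AbsRing) (V := R_CompleteNormedModule)) with (2 := hgeom).
  intros n; apply Rabs_le_of_sqr; [apply hpos|].
  specialize (hstep n). pose proof (pow2_ge_0 (snd (q (S n)) - snd (q n))); lra. }
destruct (is_lim_seq_of_ex_series_diff (fun n => snd (q n))) as [b hb].
{ apply (ex_series_le (K := R_AbsRing) (V := R_CompleteNormedModule)) with (2 := hgeom).
  intros n; apply Rabs_le_of_sqr; [apply hpos|].
  specialize (hstep n). pose proof (pow2_ge_0 (fst (q (S n)) - fst (q n))); lra. }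
exists a, b.
assert (hlim : is_lim_seq (fun n => Rabs (fst (q n) - a) + Rabs (snd (q n) - b)) 0).
{ replace 0 with (Rabs (a - a) + Rabs (b - b)) by (rewrite !Rminus_diag, Rabs_R0; ring).
  apply is_lim_seq_plus'.
  - apply (is_lim_seq_abs _ (a - a)), is_lim_seq_minus'; [exact ha | apply is_lim_seq_const].
  - apply (is_lim_seq_abs _ (b - b)), is_lim_seq_minus'; [exact hb | apply is_lim_seq_const]. }
(* Each coordinate alone inherits the Lipschitz bound because the other square is nonnegative, so
   this continuity claim serves both [f1] and [f2]. *)
assert (hcont : forall (f : R -> R -> R),
  (forall n, (f (fst (q n)) (snd (q n)) - f a b) ^ 2
     <= L ^ 2 * ((fst (q n) - a) ^ 2 + (snd (q n) - b) ^ 2)) ->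
  is_lim_seq (fun n => f (fst (q n)) (snd (q n))) (f a b)).
{ intros f h.
  assert (h0 : is_lim_seq (fun n => f (fst (q n)) (snd (q n)) - f a b) 0).
  { apply is_lim_seq_abs_0.
    apply is_lim_seq_le_le with (fun _ => 0)
      (fun n => Rabs (fst (q n) - a) + Rabs (snd (q n) - b)).
    - intros n; split; [apply Rabs_pos|].
      apply Rabs_le_of_sum_sqr. specialize (h n).
      assert (0 <= (fst (q n) - a) ^ 2 + (snd (q n) - b) ^ 2)
        by (apply Rplus_le_le_0_compat; apply pow2_ge_0).
      apply Rle_trans with (1 := h).
      rewrite <- (Rmult_1_l ((fst (q n) - a) ^ 2 + (snd (q n) - b) ^ 2)) at 2.
      apply Rmult_le_compat_r; [assumption | nra].
    - apply is_lim_seq_const.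
    - exact hlim. }
  apply is_lim_seq_ext with (fun n => (f (fst (q n)) (snd (q n)) - f a b) + f a b).
  - intros n; ring.
  - replace (Finite (f a b)) with (Finite (0 + f a b)) by (f_equal; ring).
    apply is_lim_seq_plus'; [exact h0 | apply is_lim_seq_const]. }
assert (huniq : forall (u : nat -> R) (x y : R), is_lim_seq u x -> is_lim_seq u y -> x = y).
{ intros u x y hx hy. apply is_lim_seq_unique in hx; apply is_lim_seq_unique in hy.
  rewrite hx in hy; congruence. }
split.
- apply (huniq (fun n => fst (q (S n)))).
  + apply is_lim_seq_ext with (1 := hq1). apply (hcont f1). intros n.
    specialize (hf (fst (q n)) (snd (q n)) a b).
    pose proof (pow2_ge_0 (f2 (fst (q n)) (snd (q n)) - f2 a b)); lra.
  + apply (is_lim_seq_incr_1 (fun n => fst (q n))); exact ha.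
- apply (huniq (fun n => snd (q (S n)))).
  + apply is_lim_seq_ext with (1 := hq2). apply (hcont f2). intros n.
    specialize (hf (fst (q n)) (snd (q n)) a b).
    pose proof (pow2_ge_0 (f1 (fst (q n)) (snd (q n)) - f1 a b)); lra.
  + apply (is_lim_seq_incr_1 (fun n => snd (q n))); exact hb.
Qed.

(* Carathéodory's form of differentiability; it turns the differentiation of an
   inverse map into the solution of a linear system with continuous coefficients. *)
Lemma caratheodory_slope (f : R -> R) (x l : R) :
  is_derive f x l ->
  exists phi : R -> R, continuous phi x /\ phi x = l /\
    forall y, f y - f x = phi y * (y - x).
Proof.
intros hf. apply is_derive_Reals in hf.
(* The difference quotient, completed at [x] by the derivative: differentiability becomes its
   continuity there. *)
exists (fun y => if Req_EM_T y x then l else (f y - f x) / (y - x)).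
split; [|split].
- apply filterlim_locally. intros eps.
  destruct (hf eps (cond_pos eps)) as [d hd].
  exists d. intros y hy.
  destruct (Req_EM_T x x) as [_|n]; [|now elim n].
  destruct (Req_EM_T y x) as [e|n]; [apply ball_center|].
  change (Rabs ((f y - f x) / (y - x) - l) < eps).
  change (Rabs (y - x) < d) in hy.
  specialize (hd (y - x)).
  rewrite Rplus_minus in hd.
  apply hd; [lra | exact hy].
- destruct (Req_EM_T x x) as [_|n]; [reflexivity | now elim n].
- intros y. destruct (Req_EM_T y x) as [->|n]; [now rewrite !Rminus_diag, Rmult_0_r|].
  field; lra.
Qed.

Lemma caratheodory_derive (f phi : R -> R) (x : R) :
  continuous phi x ->
  locally x (fun y => f y - f x = phi y * (y - x)) ->
  is_derive f x (phi x).
Proof.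
intros hphi hloc. apply is_derive_Reals. intros eps heps.
destruct hloc as [d1 h1].
destruct (proj1 (filterlim_locally _ _) hphi (mkposreal eps heps)) as [d2 h2].
assert (hd : 0 < Rmin d1 d2) by (apply Rmin_pos; apply cond_pos).
exists (mkposreal _ hd). intros h hh0 hh. simpl in hh.
assert (b1 : ball x d1 (x + h)).
{ change (Rabs (x + h - x) < d1). replace (x + h - x) with h by ring.
  apply Rlt_le_trans with (1 := hh), Rmin_l. }
assert (b2 : ball x d2 (x + h)).
{ change (Rabs (x + h - x) < d2). replace (x + h - x) with h by ring.
  apply Rlt_le_trans with (1 := hh), Rmin_r. }
rewrite (h1 _ b1).
replace (phi (x + h) * (x + h - x) / h) with (phi (x + h)) by (field; exact hh0).
exact (h2 _ b2).
Qed.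

(** * Lipschitz estimate for the orbital displacement *)

(** By the half-angle formula the left side is [4 * sin (x / 2) ^ 2], and the mean value theorem
    bounds the sine by its argument. *)
Lemma one_sub_cos_le (x : R) : 2 * (1 - cos x) <= x ^ 2.
Proof.
replace x with (2 * (x / 2)) at 1 by field.
rewrite cos_2a_sin.
assert (h : Rabs (sin (x / 2)) <= Rabs (x / 2)).
{ destruct (MVT_gen sin 0 (x / 2) cos) as [y [_ hy]].
  - intros z _. auto_derive; [trivial | ring].
  - intros z _. apply continuity_sin.
  - rewrite sin_0, !Rminus_0_r in hy. rewrite hy, Rabs_mult.
    assert (Rabs (cos y) <= 1) by (apply Rabs_le, COS_bound).
    pose proof (Rabs_pos (x / 2)). nra. }
apply Rsqr_le_abs_1 in h. unfold Rsqr in h. nra.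
Qed.

Lemma exp_le_compat (x y : R) : x <= y -> exp x <= exp y.
Proof.
intros [h | ->]; [apply Rlt_le; now apply exp_increasing | apply Rle_refl].
Qed.

Lemma exp_sub_sqr_le (k M x y : R) : 0 <= k -> x <= M -> y <= M ->
  (exp (k * x) - exp (k * y)) ^ 2 <= (k * exp (k * M)) ^ 2 * (x - y) ^ 2.
Proof.
intros hk hx hy.
destruct (MVT_gen (fun z => exp (k * z)) y x (fun z => k * exp (k * z))) as [z [hz e]].
- intros z _. auto_derive; [trivial | ring].
- intros z _. apply derivable_continuous_pt. exists (k * exp (k * z)).
  apply is_derive_Reals. auto_derive; [trivial | ring].
- rewrite e, Rpow_mult_distr.
  apply Rmult_le_compat_r; [apply pow2_ge_0|].
  assert (hzM : exp (k * z) <= exp (k * M)).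
  { apply exp_le_compat, Rmult_le_compat_l; [lra|].
    assert (Rmax y x <= M) by (now apply Rmax_lub). lra. }
  apply pow_incr. pose proof (exp_pos (k * z)). split; [nra|].
  now apply Rmult_le_compat_l.
Qed.

(** The orbital displacement has polar form with radius [exp (k * b) / k] and angle [k * a]. The law
    of cosines splits the squared distance into a radial part, bounded by the mean value theorem,
    and an angular part, bounded by [one_sub_cos_le]. *)
Lemma orbit_lipschitz (k M a b a' b' : R) : 0 < k -> b <= M -> b' <= M ->
  (exp (k * b) / k * sin (k * a) - exp (k * b') / k * sin (k * a')) ^ 2
  + (exp (k * b) / k * cos (k * a) - exp (k * b') / k * cos (k * a')) ^ 2
  <= exp (k * M) ^ 2 * ((a - a') ^ 2 + (b - b') ^ 2).
Proof.
intros hk hb hb'.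
assert (hE := exp_sub_sqr_le k M b b' (Rlt_le _ _ hk) hb hb').
assert (hc := one_sub_cos_le (k * a - k * a')).
rewrite cos_minus in hc.
assert (h1 : exp (k * b) <= exp (k * M)) by (apply exp_le_compat; nra).
assert (h2 : exp (k * b') <= exp (k * M)) by (apply exp_le_compat; nra).
assert (p1 := exp_pos (k * b)). assert (p2 := exp_pos (k * b')).
assert (s1 := sin2_cos2 (k * a)). assert (s2 := sin2_cos2 (k * a')).
unfold Rsqr in s1, s2.
revert hE hc h1 h2 p1 p2 s1 s2.
generalize (exp (k * b)) (exp (k * b')) (exp (k * M)) (sin (k * a)) (cos (k * a))
  (sin (k * a')) (cos (k * a')).
intros E E' L s c s' c' hE hc h1 h2 p1 p2 s1 s2.
apply Rmult_le_reg_l with (k ^ 2); [nra|].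
(* The law of cosines as a polynomial identity: the last two terms carry the defects of
   [s * s + c * c = 1] and its primed analogue, and vanish. *)
replace (k ^ 2 * ((E / k * s - E' / k * s') ^ 2 + (E / k * c - E' / k * c') ^ 2))
  with ((E - E') ^ 2 + E * E' * (2 * (1 - (c * c' + s * s')))
    + (s * s + c * c - 1) * E ^ 2 + (s' * s' + c' * c' - 1) * E' ^ 2)
  by (field; lra).
rewrite s1, s2.
assert (hEE : E * E' <= L ^ 2) by nra.
assert (h3 : E * E' * (2 * (1 - (c * c' + s * s'))) <= E * E' * (k * a - k * a') ^ 2)
  by (apply Rmult_le_compat_l; [nra | exact hc]).
assert (h4 : E * E' * (k * a - k * a') ^ 2 <= L ^ 2 * (k * a - k * a') ^ 2)
  by (apply Rmult_le_compat_r; [apply pow2_ge_0 | exact hEE]).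
nra.
Qed.

(** Here [v] is a displacement, [p] its image under the identity plus a perturbation, and [v - p]
    is, up to sign, the change of the perturbation. Expanding gives [(1 - L ^ 2)] |v|^2 <= 2 v.p -
    |p|^2, and completing the square removes v.p. The constant is not sharp, but it avoids square
    roots. *)
Lemma contraction_perturbation_bound (L v1 v2 p1 p2 : R) : 0 <= L < 1 ->
  (v1 - p1) ^ 2 + (v2 - p2) ^ 2 <= L ^ 2 * (v1 ^ 2 + v2 ^ 2) ->
  v1 ^ 2 + v2 ^ 2 <= (2 / (1 - L ^ 2)) ^ 2 * (p1 ^ 2 + p2 ^ 2).
Proof.
intros hL h.
set (d := 1 - L ^ 2).
assert (hd : 0 < d) by (unfold d; nra).
apply Rmult_le_reg_l with (d ^ 2); [nra|].
replace (d ^ 2 * ((2 / d) ^ 2 * (p1 ^ 2 + p2 ^ 2))) with (4 * (p1 ^ 2 + p2 ^ 2))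
  by (field; lra).
assert (h' : d * (v1 ^ 2 + v2 ^ 2) <= 2 * (v1 * p1 + v2 * p2) - (p1 ^ 2 + p2 ^ 2))
  by (unfold d; nra).
assert (q1 := pow2_ge_0 (d * v1 - 2 * p1)). assert (q2 := pow2_ge_0 (d * v2 - 2 * p2)).
assert (h2 := Rmult_le_compat_l (2 * d) _ _ ltac:(lra) h').
nra.
Qed.

(** * Injectivity and local inversion of the steady map *)

(** With [trochoidZ], the components of the map [F]; the image of a horizontal line is a
    trochoid. *)
Definition trochoidX (k a b : R) : R := a - exp (k * b) / k * sin (k * a).
Definition trochoidZ (k a b : R) : R := b + exp (k * b) / k * cos (k * a).

Lemma Phi_trochoid (k c m t : R) (q : R * R) :
  Phi k c m t q = (trochoidX k (fst q - m * t) (snd q) + c * t,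
                   trochoidZ k (fst q - m * t) (snd q)).
Proof.
unfold Phi, pathX, pathZ, trochoidX, trochoidZ; f_equal; ring.
Qed.

Lemma exp_contraction (k M : R) : 0 < k -> M < 0 -> 0 <= exp (k * M) < 1.
Proof.
intros hk hM. split; [apply Rlt_le, exp_pos|].
rewrite <- exp_0. apply exp_increasing. nra.
Qed.

(** Quantitative injectivity: the identity dominates the orbital displacement, whose Lipschitz
    constant [exp (k * M)] is below 1. *)
Lemma trochoid_expansion (k M a b a' b' : R) : 0 < k -> M < 0 -> b <= M -> b' <= M ->
  (a - a') ^ 2 + (b - b') ^ 2 <= (2 / (1 - exp (k * M) ^ 2)) ^ 2
   * ((trochoidX k a b - trochoidX k a' b') ^ 2 + (trochoidZ k a b - trochoidZ k a' b') ^ 2).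
Proof.
intros hk hM hb hb'.
apply contraction_perturbation_bound; [now apply exp_contraction|].
apply Rle_trans with (2 := orbit_lipschitz k M a b a' b' hk hb hb').
apply Req_le. unfold trochoidX, trochoidZ. ring.
Qed.

Lemma trochoid_inj (k a b a' b' : R) : 0 < k -> b < 0 -> b' < 0 ->
  trochoidX k a b = trochoidX k a' b' -> trochoidZ k a b = trochoidZ k a' b' ->
  a = a' /\ b = b'.
Proof.
intros hk hb hb' e1 e2.
(* The higher of the two labels is a negative level lying above both points. *)
assert (h := trochoid_expansion k (Rmax b b') a b a' b' hk
  ltac:(now apply Rmax_lub_lt) (Rmax_l _ _) (Rmax_r _ _)).
rewrite e1, e2, !Rminus_diag in h.
replace (0 ^ 2 + 0 ^ 2) with 0 in h by ring. rewrite Rmult_0_r in h.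
assert (ha := pow2_ge_0 (a - a')). assert (hb2 := pow2_ge_0 (b - b')).
split; apply Rminus_diag_uniq, Rsqr_0_uniq; unfold Rsqr; lra.
Qed.

(* Freezing the vertical label above level [M] makes the perturbation of the
   identity a contraction of the whole plane; the level is not reached for data
   close to those of [(a0, b0)]. *)
Lemma trochoid_local_inverse (k a0 b0 B eps : R) : 0 < k -> b0 < B -> B <= 0 -> 0 < eps ->
  exists d : R, 0 < d /\ forall x z,
    Rabs (x - trochoidX k a0 b0) < d -> Rabs (z - trochoidZ k a0 b0) < d ->
    exists a b, b < B /\ trochoidX k a b = x /\ trochoidZ k a b = z
      /\ Rabs (a - a0) < eps /\ Rabs (b - b0) < eps.
Proof.
intros hk hb0 hB heps.
set (M := (b0 + B) / 2).
assert (hM : M < 0) by (unfold M; lra).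
assert (hbM : b0 < M) by (unfold M; lra).
assert (hMB : M < B) by (unfold M; lra).
clearbody M.
assert (hL := exp_contraction k M hk hM).
set (L := exp (k * M)) in *.
set (C := 2 / (1 - L ^ 2)).
assert (hC : 0 < C) by (unfold C; apply Rdiv_lt_0_compat; nra).
set (r := Rmin eps (M - b0)).
assert (hr : 0 < r) by (apply Rmin_pos; lra).
(* With both errors below this [d], the squared label distance is below [2 * C ^ 2 * d ^ 2], which
   is [r ^ 2 / 2]. *)
exists (r / (2 * C)). split; [apply Rdiv_lt_0_compat; lra|].
intros x z hx hz.
(* Truncation at [M] is 1-Lipschitz, so the truncated displacement keeps the constant [L]. *)
assert (hmin : forall b b', (Rmin b M - Rmin b' M) ^ 2 <= (b - b') ^ 2).
{ intros b b'. unfold Rmin.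
  destruct (Rle_dec b M) as [h|h%Rnot_le_lt], (Rle_dec b' M) as [h'|h'%Rnot_le_lt].
  - apply Rle_refl.
  - pose proof (Rmult_le_pos (b' - M) (b' + M - 2 * b) ltac:(lra) ltac:(lra)); lra.
  - pose proof (Rmult_le_pos (b - M) (b + M - 2 * b') ltac:(lra) ltac:(lra)); lra.
  - rewrite Rminus_diag, pow_i by auto. apply pow2_ge_0. }
assert (hlip : forall a b a' b',
  (exp (k * Rmin b M) / k * sin (k * a) - exp (k * Rmin b' M) / k * sin (k * a')) ^ 2
  + (exp (k * Rmin b M) / k * cos (k * a) - exp (k * Rmin b' M) / k * cos (k * a')) ^ 2
  <= L ^ 2 * ((a - a') ^ 2 + (b - b') ^ 2)).
{ intros a b a' b'.
  apply Rle_trans with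
    (1 := orbit_lipschitz k M a (Rmin b M) a' (Rmin b' M) hk (Rmin_r _ _) (Rmin_r _ _)).
  apply Rmult_le_compat_l; [apply pow2_ge_0|].
  specialize (hmin b b'). lra. }
(* A fixed point of this map is a solution of the truncated equation [F (a, b) = (x, z)]. *)
destruct (planar_contraction_fixpoint
  (fun a b => x + exp (k * Rmin b M) / k * sin (k * a))
  (fun a b => z - exp (k * Rmin b M) / k * cos (k * a)) L hL) as [a [b [ea eb]]].
{ intros a b a' b'. apply Rle_trans with (2 := hlip a b a' b').
  apply Req_le. ring. }
assert (hdist : (a - a0) ^ 2 + (b - b0) ^ 2
  <= C ^ 2 * ((x - trochoidX k a0 b0) ^ 2 + (z - trochoidZ k a0 b0) ^ 2)).
{ apply contraction_perturbation_bound; [exact hL|].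
  apply Rle_trans with (2 := hlip a b a0 b0).
  rewrite (Rmin_left b0 M) by lra.
  apply Req_le. unfold trochoidX, trochoidZ.
  replace (exp (k * Rmin b M) / k * sin (k * a)) with (a - x) by lra.
  replace (exp (k * Rmin b M) / k * cos (k * a)) with (z - b) by lra.
  ring. }
assert (hsq : (a - a0) ^ 2 + (b - b0) ^ 2 < r ^ 2).
{ apply Rle_lt_trans with (1 := hdist).
  assert (hd0 : 0 < r / (2 * C)) by (apply Rdiv_lt_0_compat; lra).
  assert (er : r = 2 * C * (r / (2 * C))) by (field; lra).
  set (d := r / (2 * C)) in *. rewrite er.
  assert (kx := pow2_abs (x - trochoidX k a0 b0)).
  assert (kz := pow2_abs (z - trochoidZ k a0 b0)).
  pose proof (Rabs_pos (x - trochoidX k a0 b0)).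
  pose proof (Rabs_pos (z - trochoidZ k a0 b0)).
  assert ((x - trochoidX k a0 b0) ^ 2 < d ^ 2) by nra.
  assert ((z - trochoidZ k a0 b0) ^ 2 < d ^ 2) by nra.
  assert (0 < C ^ 2) by nra.
  nra. }
assert (hlt : forall v, v ^ 2 < r ^ 2 -> Rabs v < r).
{ intros v hv. rewrite <- (Rabs_pos_eq r) by lra.
  apply Rsqr_lt_abs_0. unfold Rsqr. nra. }
assert (ha : Rabs (a - a0) < r) by (apply hlt; pose proof (pow2_ge_0 (b - b0)); lra).
assert (hb : Rabs (b - b0) < r) by (apply hlt; pose proof (pow2_ge_0 (a - a0)); lra).
assert (r1 : r <= eps) by apply Rmin_l.
assert (r2 : r <= M - b0) by apply Rmin_r.
(* Since [r <= M - b0], the solution stays below the truncation level and solves the original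
   equation. *)
assert (hbM' : b < M) by (apply Rabs_def2 in hb; lra).
rewrite Rmin_left in ea, eb by lra.
exists a, b. unfold trochoidX, trochoidZ. repeat split; lra.
Qed.

(** * Derivatives of the labels along a line *)

(** Replacing increments of sine, cosine and exponential by slopes times increments gives an exact
    linear system for those of [A] and [B]. Its coefficients are continuous at [s0], so Cramer's
    rule exhibits continuous slopes of [A] and [B]. *)
Lemma trochoid_preimage_derive (k : R) (A B : R -> R) (s0 d1 d2 : R) :
  0 < k -> B s0 < 0 -> continuous A s0 -> continuous B s0 ->
  locally s0 (fun s => trochoidX k (A s) (B s) - trochoidX k (A s0) (B s0) = d1 * (s - s0)
    /\ trochoidZ k (A s) (B s) - trochoidZ k (A s0) (B s0) = d2 * (s - s0)) ->
  let e := exp (k * B s0) in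
  let S := sin (k * A s0) in
  let C := cos (k * A s0) in
  is_derive A s0 ((d1 * (1 + e * C) + d2 * (e * S)) / (1 - e ^ 2)) /\
  is_derive B s0 ((d1 * (e * S) + d2 * (1 - e * C)) / (1 - e ^ 2)).
Proof.
intros hk hB cA cB hloc e S C.
destruct (caratheodory_slope (fun a => sin (k * a)) (A s0) (k * C)) as [fs [cs [es hs]]].
{ auto_derive; [trivial | unfold C; ring]. }
destruct (caratheodory_slope (fun a => cos (k * a)) (A s0) (- (k * S))) as [fc [cc [ec hc]]].
{ auto_derive; [trivial | unfold S; ring]. }
destruct (caratheodory_slope (fun b => exp (k * b)) (B s0) (k * e)) as [fe [ce [ee he]]].
{ auto_derive; [trivial | unfold e; ring]. }
(* Products are split asymmetrically: the exponential is taken at [B s] when the angle varies, and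
   the angle is frozen at [A s0] when the exponential varies. *)
pose (a11 := fun s => 1 - exp (k * B s) * fs (A s) / k).
pose (a12 := fun s => - (fe (B s) * S / k)).
pose (a21 := fun s => exp (k * B s) * fc (A s) / k).
pose (a22 := fun s => 1 + fe (B s) * C / k).
pose (det := fun s => a11 s * a22 s - a12 s * a21 s).
assert (cfs : continuous (fun s => fs (A s)) s0) by (now apply continuous_comp).
assert (cfc : continuous (fun s => fc (A s)) s0) by (now apply continuous_comp).
assert (cfe : continuous (fun s => fe (B s)) s0) by (now apply continuous_comp).
assert (cexp : continuous (fun s => exp (k * B s)) s0).
{ apply (continuous_comp B (fun b => exp (k * b))); [exact cB|].
  apply (ex_derive_continuous (fun b => exp (k * b))). auto_derive; trivial. }
assert (cst : forall x : R, continuous (fun _ : R => x) s0) by (intros; apply continuous_const).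
assert (cmul : forall f g : R -> R, continuous f s0 -> continuous g s0 ->
   continuous (fun s => f s * g s) s0).
{ intros; now apply (continuous_mult (K := R_AbsRing)). }
assert (cadd : forall f g : R -> R, continuous f s0 -> continuous g s0 ->
   continuous (fun s => f s + g s) s0).
{ intros; now apply (continuous_plus (V := R_NormedModule)). }
assert (csub : forall f g : R -> R, continuous f s0 -> continuous g s0 ->
   continuous (fun s => f s - g s) s0).
{ intros; now apply (continuous_minus (V := R_NormedModule)). }
assert (copp : forall f : R -> R, continuous f s0 -> continuous (fun s => - f s) s0).
{ intros; now apply (continuous_opp (V := R_NormedModule)). }
assert (c11 : continuous a11 s0) by (unfold a11, Rdiv; auto 6).
assert (c12 : continuous a12 s0) by (unfold a12, Rdiv; auto 6).
assert (c21 : continuous a21 s0) by (unfold a21, Rdiv; auto 6).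
assert (c22 : continuous a22 s0) by (unfold a22, Rdiv; auto 6).
assert (cdet : continuous det s0) by (unfold det; auto 6).
assert (he1 : 0 <= e < 1) by (now apply exp_contraction).
assert (hSC : S * S + C * C = 1).
{ pose proof (sin2_cos2 (k * A s0)) as h. exact h. }
assert (v11 : a11 s0 = 1 - e * C) by (unfold a11; rewrite es; fold e; field; lra).
assert (v12 : a12 s0 = - (e * S)) by (unfold a12; rewrite ee; field; lra).
assert (v21 : a21 s0 = - (e * S)) by (unfold a21; rewrite ec; fold e; field; lra).
assert (v22 : a22 s0 = 1 + e * C) by (unfold a22; rewrite ee; field; lra).
(* At [s0] the matrix is the Jacobian matrix of [F]. *)
assert (vdet : det s0 = 1 - e ^ 2).
{ unfold det. rewrite v11, v12, v21, v22.
  replace (1 - e ^ 2) with (1 - e ^ 2 * (S * S + C * C)) by (rewrite hSC; ring). ring. }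
assert (hdet0 : det s0 <> 0) by (rewrite vdet; nra).
assert (hdet : locally s0 (fun s => det s <> 0)).
{ exact (cdet _ (open_neq 0 _ hdet0)). }
assert (cinv : continuous (fun s => / det s) s0).
{ apply (continuous_comp det Rinv); [exact cdet|]. now apply continuous_Rinv. }
assert (hsys : locally s0 (fun s => det s <> 0
   /\ a11 s * (A s - A s0) + a12 s * (B s - B s0) = d1 * (s - s0)
   /\ a21 s * (A s - A s0) + a22 s * (B s - B s0) = d2 * (s - s0))).
{ apply (filter_imp (fun s => det s <> 0 /\
    (trochoidX k (A s) (B s) - trochoidX k (A s0) (B s0) = d1 * (s - s0)
    /\ trochoidZ k (A s) (B s) - trochoidZ k (A s0) (B s0) = d2 * (s - s0)))).
  2: now apply filter_and.
  intros s [hd [h1 h2]]. split; [exact hd|].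
  rewrite <- h1, <- h2. unfold trochoidX, trochoidZ.
  specialize (hs (A s)); specialize (hc (A s)); specialize (he (B s)). simpl in hs, hc, he.
  fold S in hs |- *. fold C in hc |- *. fold e in he |- *.
  unfold a11, a12, a21, a22.
  replace (sin (k * A s)) with (S + fs (A s) * (A s - A s0)) by lra.
  replace (cos (k * A s)) with (C + fc (A s) * (A s - A s0)) by lra.
  split.
  - replace e with (exp (k * B s) - fe (B s) * (B s - B s0)) by lra. field; lra.
  - replace e with (exp (k * B s) - fe (B s) * (B s - B s0)) by lra. field; lra. }
split.
- replace ((d1 * (1 + e * C) + d2 * (e * S)) / (1 - e ^ 2))
    with ((d1 * a22 s0 - d2 * a12 s0) * / det s0) by (rewrite vdet, v22, v12; field; nra).
  apply (caratheodory_derive A (fun s => (d1 * a22 s - d2 * a12 s) * / det s)); [auto 6|].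
  apply filter_imp with (2 := hsys). intros s [hd [h1 h2]].
  apply Rmult_eq_reg_l with (det s); [|exact hd].
  transitivity (a22 s * (d1 * (s - s0)) - a12 s * (d2 * (s - s0))); [|field; exact hd].
  rewrite <- h1, <- h2. unfold det. ring.
- replace ((d1 * (e * S) + d2 * (1 - e * C)) / (1 - e ^ 2))
    with ((d2 * a11 s0 - d1 * a21 s0) * / det s0) by (rewrite vdet, v11, v21; field; nra).
  apply (caratheodory_derive B (fun s => (d2 * a11 s - d1 * a21 s) * / det s)); [auto 6|].
  apply filter_imp with (2 := hsys). intros s [hd [h1 h2]].
  apply Rmult_eq_reg_l with (det s); [|exact hd].
  transitivity (a11 s * (d2 * (s - s0)) - a21 s * (d1 * (s - s0))); [|field; exact hd].
  rewrite <- h1, <- h2. unfold det. ring.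
Qed.

(** * The Eulerian fields and their derivatives *)

(** Injectivity forces the preimage chosen by [epsilon] to be the exhibited one. *)
Lemma Phi_inv_unique (k c m b0 t X Z a b : R) : 0 < k -> b0 <= 0 -> b < b0 ->
  trochoidX k a b = X - c * t -> trochoidZ k a b = Z ->
  Phi_inv k c m b0 t (X, Z) = (a + m * t, b).
Proof.
intros hk hb0 hb eX eZ.
assert (hex : exists q, Sigma b0 q /\ Phi k c m t q = (X, Z)).
{ exists (a + m * t, b). split; [exact hb|].
  rewrite Phi_trochoid. simpl. replace (a + m * t - m * t) with a by ring.
  rewrite eX, eZ. f_equal; ring. }
assert (hs := epsilon_spec (inhabits (0, 0)) _ hex). fold (Phi_inv k c m b0 t (X, Z)) in hs.
destruct (Phi_inv k c m b0 t (X, Z)) as [a' b'].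
rewrite Phi_trochoid in hs. unfold Sigma in hs. simpl in hs. destruct hs as [hb' e].
injection e as e1 e2.
destruct (trochoid_inj k (a' - m * t) b' a b) as [ea eb]; try lra.
f_equal; lra.
Qed.

(** Only the steady position [(X - c * T, Z)] needs to be affine in [s], so one statement covers all
    three partial derivatives: the directions are [(-c, 0)] for time, [(1, 0)] for [X] and [(0, 1)]
    for [Z]. *)
Lemma label_derive (k c m b0 : R) (T X Z : R -> R) (s0 a b d1 d2 : R) :
  0 < k -> b0 <= 0 -> b < b0 ->
  (forall s, X s - c * T s = trochoidX k a b + d1 * (s - s0)) ->
  (forall s, Z s = trochoidZ k a b + d2 * (s - s0)) ->
  let A := fun s => fst (Phi_inv k c m b0 (T s) (X s, Z s)) - m * T s in
  let B := fun s => snd (Phi_inv k c m b0 (T s) (X s, Z s)) in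
  let e := exp (k * b) in
  let S := sin (k * a) in
  let C := cos (k * a) in
  A s0 = a /\ B s0 = b /\
  is_derive A s0 ((d1 * (1 + e * C) + d2 * (e * S)) / (1 - e ^ 2)) /\
  is_derive B s0 ((d1 * (e * S) + d2 * (1 - e * C)) / (1 - e ^ 2)).
Proof.
intros hk hb0 hb hX hZ A B e S C.
assert (h0 : A s0 = a /\ B s0 = b).
{ unfold A, B. rewrite (Phi_inv_unique k c m b0 (T s0) (X s0) (Z s0) a b hk hb0 hb).
  - simpl; split; ring.
  - rewrite hX; ring.
  - rewrite hZ; ring. }
destruct h0 as [hA0 hB0].
(* The local inverse supplies labels near [(a, b)] and below [b0]; by uniqueness they are the values
   of [Phi_inv], which gives the continuity of [A] and [B]. *)
assert (hnear : forall eps, 0 < eps -> locally s0 (fun s =>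
  trochoidX k (A s) (B s) = X s - c * T s /\ trochoidZ k (A s) (B s) = Z s
  /\ Rabs (A s - a) < eps /\ Rabs (B s - b) < eps)).
{ intros eps heps.
  destruct (trochoid_local_inverse k a b b0 eps hk hb hb0 heps) as [d [hd hinv]].
  assert (hlin : forall di, locally s0 (fun s => Rabs (di * (s - s0)) < d)).
  { intros di.
    (* Adding 1 keeps the radius well defined when [di = 0]. *)
    assert (hp : 0 < Rabs di + 1) by (pose proof (Rabs_pos di); lra).
    exists (mkposreal _ (Rdiv_lt_0_compat _ _ hd hp)). intros s hs.
    change (Rabs (s - s0) < d / (Rabs di + 1)) in hs.
    rewrite Rabs_mult.
    apply (Rmult_lt_compat_l (Rabs di + 1)) in hs; [|exact hp].
    replace ((Rabs di + 1) * (d / (Rabs di + 1))) with d in hs by (field; lra).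
    pose proof (Rabs_pos (s - s0)). nra. }
  apply filter_imp with (2 := filter_and _ _ (hlin d1) (hlin d2)).
  intros s [h1 h2].
  destruct (hinv (X s - c * T s) (Z s)) as [a' [b' [hb' [e1 [e2 [ha1 hb1]]]]]].
  - rewrite hX. match goal with |- Rabs ?v < _ => replace v with (d1 * (s - s0)) by ring end.
    exact h1.
  - rewrite hZ. match goal with |- Rabs ?v < _ => replace v with (d2 * (s - s0)) by ring end.
    exact h2.
  - unfold A, B. rewrite (Phi_inv_unique k c m b0 _ _ _ a' b' hk hb0 hb' e1 e2). simpl.
    replace (a' + m * T s - m * T s) with a' by ring. auto. }
split; [exact hA0|]. split; [exact hB0|].
assert (cA : continuous A s0).
{ apply filterlim_locally. intros eps.
  apply filter_imp with (2 := hnear eps (cond_pos eps)).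
  intros s [_ [_ [h _]]]. rewrite hA0. exact h. }
assert (cB : continuous B s0).
{ apply filterlim_locally. intros eps.
  apply filter_imp with (2 := hnear eps (cond_pos eps)).
  intros s [_ [_ [_ h]]]. rewrite hB0. exact h. }
unfold e, S, C. rewrite <- hA0, <- hB0.
apply trochoid_preimage_derive; [exact hk | rewrite hB0; lra | exact cA | exact cB |].
apply filter_imp with (2 := hnear 1 Rlt_0_1).
intros s [h1 [h2 _]]. rewrite h1, h2, hX, hZ, hA0, hB0. split; ring.
Qed.

Lemma velU_label (k c m b0 t X Z : R) : 0 < k ->
  let q := Phi_inv k c m b0 t (X, Z) in
  velU k c m b0 t X Z = c - m + m * (exp (k * snd q) * cos (k * (fst q - m * t))).
Proof.
intros hk q. unfold velU. fold q. apply is_derive_unique. unfold pathX.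
auto_derive; [trivial | unfold Rminus; field; lra].
Qed.

Lemma velW_label (k c m b0 t X Z : R) : 0 < k ->
  let q := Phi_inv k c m b0 t (X, Z) in
  velW k c m b0 t X Z = m * (exp (k * snd q) * sin (k * (fst q - m * t))).
Proof.
intros hk q. unfold velW. fold q. apply is_derive_unique. unfold pathZ.
auto_derive; [trivial | unfold Rminus; field; lra].
Qed.

Lemma flow_derive (k g rho b0 P0 m c : R) (T X Z : R -> R) (s0 a b d1 d2 : R) :
  0 < k -> b0 <= 0 -> b < b0 ->
  (forall s, X s - c * T s = trochoidX k a b + d1 * (s - s0)) ->
  (forall s, Z s = trochoidZ k a b + d2 * (s - s0)) ->
  let e := exp (k * b) in
  let S := sin (k * a) in
  let C := cos (k * a) in
  let A' := (d1 * (1 + e * C) + d2 * (e * S)) / (1 - e ^ 2) in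
  let B' := (d1 * (e * S) + d2 * (1 - e * C)) / (1 - e ^ 2) in
  velU k c m b0 (T s0) (X s0) (Z s0) = c - m + m * (e * C) /\
  velW k c m b0 (T s0) (X s0) (Z s0) = m * (e * S) /\
  is_derive (fun s => velU k c m b0 (T s) (X s) (Z s)) s0 (m * k * e * (B' * C - A' * S)) /\
  is_derive (fun s => velW k c m b0 (T s) (X s) (Z s)) s0 (m * k * e * (B' * S + A' * C)) /\
  is_derive (fun s => pressure k g rho b0 P0 0 m c (T s) (X s) (Z s)) s0
    (rho * (k * m ^ 2 * e ^ 2 - g) * B').
Proof.
intros hk hb0 hb hX hZ e S C A' B'.
destruct (label_derive k c m b0 T X Z s0 a b d1 d2 hk hb0 hb hX hZ) as [hA0 [hB0 [hA hB]]].
cbv zeta in hA, hB. fold e S C A' in hA. fold e S C B' in hB.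
set (A := fun s => fst (Phi_inv k c m b0 (T s) (X s, Z s)) - m * T s) in *.
set (B := fun s => snd (Phi_inv k c m b0 (T s) (X s, Z s))) in *.
change (A s0 = a) in hA0. change (B s0 = b) in hB0.
assert (eA := is_derive_unique _ _ _ hA : Derive A s0 = A').
assert (eB := is_derive_unique _ _ _ hB : Derive B s0 = B').
assert (xA : ex_derive A s0) by (exists A'; exact hA).
assert (xB : ex_derive B s0) by (exists B'; exact hB).
assert (hU : forall s, c - m + m * (exp (k * B s) * cos (k * A s))
   = velU k c m b0 (T s) (X s) (Z s)) by (intros s; now rewrite velU_label).
assert (hW : forall s, m * (exp (k * B s) * sin (k * A s))
   = velW k c m b0 (T s) (X s) (Z s)) by (intros s; now rewrite velW_label).
split; [|split; [|split; [|split]]].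
- rewrite <- hU, hA0, hB0. reflexivity.
- rewrite <- hW, hA0, hB0. reflexivity.
- apply is_derive_ext with (1 := hU). auto_derive; [auto|].
  change (Derive (fun x => A x)) with (Derive A). change (Derive (fun x => B x)) with (Derive B).
  rewrite eA, eB, hA0, hB0. unfold e, S, C. ring.
- apply is_derive_ext with (1 := hW). auto_derive; [auto|].
  change (Derive (fun x => A x)) with (Derive A). change (Derive (fun x => B x)) with (Derive B).
  rewrite eA, eB, hA0, hB0. unfold e, S, C. ring.
- change (is_derive (fun s => pressure_label k g rho b0 P0 0 m c (B s)) s0
    (rho * (k * m ^ 2 * e ^ 2 - g) * B')).
  unfold pressure_label. auto_derive; [auto|].
  change (Derive (fun x => B x)) with (Derive B).
  rewrite eB, hB0.
  replace (exp (2 * k * b)) with (e ^ 2)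
    by (unfold e; simpl; rewrite Rmult_1_r, <- exp_plus; f_equal; ring).
  field; lra.
Qed.

(** A two-sided derivative survives restriction of the filter to nonnegative times, including at
    [t = 0]. *)
Lemma is_derive_is_time_derive (f : R -> R) (t l : R) :
  0 <= t -> is_derive f t l -> is_time_derive f t l.
Proof.
intros ht [h1 h2]. split; [exact h1|].
intros x hx.
(* As [0 <= t], every set of the restricted filter contains [t], so it can converge only to [t]. *)
assert (ext : t = x).
{ apply cond_eq. intros eps heps.
  assert (h := hx _ (locally_ball x (mkposreal eps heps))).
  exact (locally_singleton _ _ h ht). }
subst x. intros eps. apply filter_le_within.
exact (h2 t (fun Q hQ => hQ) eps).
Qed.

(** * The momentum equations *)

Theorem lemma3p2 (k g rho b0 P0 omega m c : R)
  (hk : 0 < k) (hg : 0 < g) (hrho : 0 < rho) (hb0 : b0 <= 0)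
  (homega : omega = 0) (hm : m ^ 2 = g / k) :
  let u := velU k c m b0 in
  let w := velW k c m b0 in
  let P := pressure k g rho b0 P0 omega m c in
  forall t X Z : R, 0 <= t -> Omega k c m b0 t (X, Z) ->
  exists ut uX uZ wt wX wZ PX PZ : R,
    (is_time_derive (fun s => u s X Z) t ut /\
     is_derive (fun x => u t x Z) X uX /\
     is_derive (fun z => u t X z) Z uZ) /\
    (is_time_derive (fun s => w s X Z) t wt /\
     is_derive (fun x => w t x Z) X wX /\
     is_derive (fun z => w t X z) Z wZ) /\
    (is_derive (fun x => P t x Z) X PX /\
     is_derive (fun z => P t X z) Z PZ) /\
    ut + u t X Z * uX + w t X Z * uZ + 2 * omega * w t X Z = - (PX / rho) /\
    wt + u t X Z * wX + w t X Z * wZ - 2 * omega * u t X Z = - (PZ / rho) - g.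
Proof.
intros u w P t X Z ht [[a b] [hb hq]].
unfold u, w, P. clear u w P. subst omega.
unfold Sigma in hb. simpl in hb. rewrite Phi_trochoid in hq. simpl in hq.
set (al := a - m * t) in hq. injection hq as hX hZ.
assert (eX : X - c * t = trochoidX k al b) by lra.
(* At a fixed place, the steady position drifts with velocity [(-c, 0)] as time passes. *)
pose proof (flow_derive k g rho b0 P0 m c (fun s => s) (fun _ => X) (fun _ => Z)
  t al b (- c) 0 hk hb0 hb ltac:(intros s; lra) ltac:(intros s; lra)) as Ht.
pose proof (flow_derive k g rho b0 P0 m c (fun _ => t) (fun x => x) (fun _ => Z)
  X al b 1 0 hk hb0 hb ltac:(intros s; lra) ltac:(intros s; lra)) as Hx.
pose proof (flow_derive k g rho b0 P0 m c (fun _ => t) (fun _ => X) (fun z => z)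
  Z al b 0 1 hk hb0 hb ltac:(intros s; lra) ltac:(intros s; lra)) as Hz.
cbv zeta beta in Ht, Hx, Hz.
destruct Ht as [vu [vw [ut [wt _]]]].
destruct Hx as [_ [_ [ux [wx px]]]].
destruct Hz as [_ [_ [uz [wz pz]]]].
do 8 eexists.
split; [split; [apply is_derive_is_time_derive; [exact ht|]; exact ut | split; [exact ux | exact uz]]|].
split; [split; [apply is_derive_is_time_derive; [exact ht|]; exact wt | split; [exact wx | exact wz]]|].
split; [split; [exact px | exact pz]|].
rewrite vu, vw.
assert (he : 0 <= exp (k * b) < 1) by (apply exp_contraction; lra).
assert (hSC := sin2_cos2 (k * al)). unfold Rsqr in hSC.
assert (hgk : g = k * m ^ 2) by (rewrite hm; field; lra).
rewrite hgk.
clear - hk hrho he hSC.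
(* What remains are rational identities in [e], [S], [C] modulo [S ^ 2 + C ^ 2 = 1], with the
   nonzero denominator [1 - e ^ 2]. *)
revert he hSC. generalize (exp (k * b)) (sin (k * al)) (cos (k * al)).
intros e S C he hSC.
assert (hd : 1 - e ^ 2 <> 0) by nra.
assert (hS2 : S ^ 2 = 1 - C ^ 2) by lra.
split; field_simplify_eq; try lra; ring [hS2].
Qed.
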